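(* Let $I=[0,1]$ and let $i_0,c_0:S^1_{\mathbb Q}\to\overrightarrow{S}^1_{\mathbb Q}\times I$ be given by $i_0(s)=(s,0)$ and $c_0(s)=(1,0)$. Then, in the category of locally ordered spaces, the quotient map $q:\overrightarrow{S}^1_{\mathbb Q}\times I\to W$ is the coequalizer of $i_0$ and $c_0$.
   Context: **Locally ordered spaces.** For posets $B,B'$ write $B\subset_{lax}B'$ when $|B|\subset|B'|$ and $p\leq_B q$ implies $p\leq_{B'}q$ for all $p,q\in B$. An *ordered basis* on a topological space $X$ is a set $\mathfrak B$ of posets whose underlying sets form a basis of the topology of $X$ and such that for all $x\in X$ and $B,B'\in\mathfrak B$ with $x\in B\cap B'$ there is $B''\in\mathfrak B$ with $x\in B''$, $B''\subset_{lax}B$ and $B''\subset_{lax}B'$. An ordered basis $\mathfrak B'$ is *coarser* than $\mathfrak B$ if for every $x\in X$ and every $B'\in\mathfrak B'$ with $x\in B'$ there is $B\in\mathfrak B$ with $x\in B\subset_{lax}B'$; two ordered bases are *equivalent* if each is coarser than the other. A *locally ordered space* is a topological space with an equivalence class of ordered bases. **Morphisms.** A map $f:X\to Y$ between locally ordered spaces with ordered bases $\mathfrak B,\mathfrak B'$ is *locally increasing at* $x$ if for all $B'\in\mathfrak B'$ with $f(x)\in B'$ there is $B\in\mathfrak B$ with $x\in B$, $f(B)\subset B'$ and $f:B\to B'$ increasing (independent of the bases in the classes). Morphisms are maps that are locally increasing at every point. The product $X\times X'$ has ordered basis $\{B\times B'\}$ with product topology and product orders. A topological space is regarded as a locally ordered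 space via the ordered basis of all its open subsets ordered by equality; $I$ and $S^1_{\mathbb Q}$ are so regarded. **Rational circle.** A *proper open arc* of $S^1=\{z\in\mathbb C:|z|=1\}$ is a set $\alpha=\{e^{ix}: x\in{]a,b[}\}$ with $0<b-a<2\pi$; its standard order $\leq_\alpha$ is $e^{ix}\leq_\alpha e^{iy}$ iff $x\leq y$, for $x,y\in{]a,b[}$. $S^1_{\mathbb Q}=\{e^{ix}: x\in\mathbb Q\}$ with the subspace topology of $S^1$. $\overrightarrow{S}^1_{\mathbb Q}$ is the same space with the ordered basis of sets $\alpha\cap S^1_{\mathbb Q}$, $\alpha$ a proper open arc, with the order induced by $\leq_\alpha$. **The space $W$.** The underlying set is $\{0\}\sqcup(S^1_{\mathbb Q}\times{]0,1]})$, with quotient map $q$ from $S^1_{\mathbb Q}\times[0,1]$: $q(s,0)=0$ and $q(s,t)=(s,t)$ for $t>0$; the topology is the quotient (final) topology of $q$. Let $\mathcal H$ be the set of continuous functions $h:S^1_{\mathbb Q}\to[0,1]$ with $h(s)>0$ for all $s$ and $\inf h=0$. For $h\in\mathcal H$, let $O_h=\{0\}\sqcup\{(s,t)\in S^1_{\mathbb Q}\times{]0,1]}: t<h(s)\}$, with the partial order $\leq_h$ defined by: $0\leq_h 0$, and $(s,t)\leq_h(s',t')$ iff $t=t'$ and there is a proper open arc $\alpha$ with $s\leq_\alpha s'$ and $(\alpha\cap S^1_{\mathbb Q})\times\{t\}\subset O_h$. The locally ordered space $W$ is given by the ordered basis consisting of all posets $(O_h,\leq_h)$, $h\in\mathcal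 H$, together with all sets $(\alpha\times{]a,b[})\cap (S^1_{\mathbb Q}\times{]0,1]})$, $\alpha$ a proper open arc and $0<a<b$, ordered by $(s,t)\leq(s',t')$ iff $s\leq_\alpha s'$ and $t=t'$. *)

(* Defs.v *)
From HB Require Import structures.
From mathcomp Require Import all_boot all_order all_algebra.
From mathcomp Require Import all_classical all_reals all_analysis.
From mathcomp Require Import complex zify ring lra.

Set Implicit Arguments.
Unset Strict Implicit.
Unset Printing Implicit Defensive.
#[local] Obligation Tactic := idtac.

Import Order.TTheory GRing.Theory Num.Theory numFieldNormedType.Exports.
Local Open Scope classical_set_scope.
Local Open Scope ring_scope.
Local Open Scope complex_scope.

(* A poset whose underlying set is a subset of [X]; the order relates only
   elements of that subset. *)
Record poset (X : Type) := Poset {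
  carrier :> set X;
  ple : X -> X -> Prop;
  ple_carrier : forall p q, ple p q -> carrier p /\ carrier q;
  ple_refl : forall p, carrier p -> ple p p;
  ple_anti : forall p q, ple p q -> ple q p -> p = q;
  ple_trans : forall p q r, ple p q -> ple q r -> ple p r }.

Definition lax_sub (X : Type) (B B' : poset X) : Prop :=
  B `<=` B' /\ forall p q, ple B p q -> ple B' p q.

Lemma lax_sub_refl X (B : poset X) : lax_sub B B.
Proof. by split. Qed.
#[local] Hint Resolve lax_sub_refl : core.

Lemma lax_sub_trans X (B B' B'' : poset X) :
  lax_sub B B' -> lax_sub B' B'' -> lax_sub B B''.
Proof.
move=> [s1 l1] [s2 l2]; split; first exact: subset_trans s1 s2.
by move=> p q /l1/l2.
Qed.

Definition ordered_basis (X : topologicalType) (BB : set (poset X)) : Prop :=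
  basis [set carrier B | B in BB] /\
  forall (x : X) (B B' : poset X), BB B -> BB B' -> carrier B x -> carrier B' x ->
    exists B'', [/\ BB B'', carrier B'' x, lax_sub B'' B & lax_sub B'' B'].

(* [coarser BB' BB] : [BB'] is coarser than [BB]. *)
Definition coarser (X : Type) (BB' BB : set (poset X)) : Prop :=
  forall (x : X) (B' : poset X), BB' B' -> carrier B' x ->
    exists B, [/\ BB B, carrier B x & lax_sub B B'].

Definition equiv_bases (X : Type) (BB BB' : set (poset X)) : Prop :=
  coarser BB BB' /\ coarser BB' BB.

Lemma coarser_refl X (BB : set (poset X)) : coarser BB BB.
Proof. by move=> x B BBB Bx; exists B. Qed.

Lemma coarser_trans X (BB1 BB2 BB3 : set (poset X)) :
  coarser BB1 BB2 -> coarser BB2 BB3 -> coarser BB1 BB3.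
Proof.
move=> c12 c23 x B /c12/[apply] -[B2 [/c23 h B2x l2]].
have [B3 [? ? l3]] := h _ B2x.
by exists B3; split=> //; exact: lax_sub_trans l3 l2.
Qed.

Lemma equiv_bases_refl X (BB : set (poset X)) : equiv_bases BB BB.
Proof. by split; exact: coarser_refl. Qed.

Lemma equiv_bases_sym X (BB BB' : set (poset X)) :
  equiv_bases BB BB' -> equiv_bases BB' BB.
Proof. by case. Qed.

Lemma equiv_bases_trans X (BB1 BB2 BB3 : set (poset X)) :
  equiv_bases BB1 BB2 -> equiv_bases BB2 BB3 -> equiv_bases BB1 BB3.
Proof. by move=> [a b] [c d]; split; [apply: coarser_trans c|apply: coarser_trans b]. Qed.

Definition basis_class (X : topologicalType) (BB : set (poset X)) :
    set (set (poset X)) :=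
  [set BB' | ordered_basis BB' /\ equiv_bases BB BB'].

(* A topological space with an equivalence class of ordered bases. *)
Record lospace := LOSpace {
  space :> topologicalType;
  bases : set (set (poset space));
  basesP : exists2 BB, ordered_basis BB & bases = basis_class BB }.
Arguments bases : clear implicits.

Definition los_of_basis (X : topologicalType) (BB : set (poset X))
    (BBP : ordered_basis BB) : lospace :=
  LOSpace (ex_intro2 _ _ BB BBP erefl).

Lemma bases_of_basis (X : topologicalType) (BB : set (poset X))
  (BBP : ordered_basis BB) : bases (los_of_basis BBP) BB.
Proof. by split=> //; exact: equiv_bases_refl. Qed.

Lemma bases_ordered (X : lospace) BB : bases X BB -> ordered_basis BB.
Proof. by case: (basesP X) => BB' _ -> []. Qed.

Lemma bases_equiv (X : lospace) BB BB' :
  bases X BB -> bases X BB' -> equiv_bases BB BB'.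
Proof.
case: (basesP X) => BB0 _ -> [_ e1] [_ e2].
exact: equiv_bases_trans (equiv_bases_sym e1) e2.
Qed.

Definition locally_increasing_wrt (X Y : Type) (BB : set (poset X))
    (BB' : set (poset Y)) (f : X -> Y) (x : X) : Prop :=
  forall B', BB' B' -> carrier B' (f x) ->
    exists B, [/\ BB B, carrier B x, f @` B `<=` B' &
      forall p q, ple B p q -> ple B' (f p) (f q)].

Lemma locally_increasing_equiv (X Y : Type) (BB1 BB2 : set (poset X))
    (BB1' BB2' : set (poset Y)) (f : X -> Y) (x : X) :
  equiv_bases BB1 BB2 -> equiv_bases BB1' BB2' ->
  locally_increasing_wrt BB1 BB1' f x -> locally_increasing_wrt BB2 BB2' f x.
Proof.
move=> [c12 _] [_ c21'] H B2' BB2'B2' B2'fx.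
have [B1' [BB1'B1' B1'fx [s' l']]] := c21' _ _ BB2'B2' B2'fx.
have [B1 [BB1B1 B1x s l]] := H _ BB1'B1' B1'fx.
have [B2 [BB2B2 B2x [s2 l2]]] := c12 _ _ BB1B1 B1x.
exists B2; split=> //.
  by move=> _ [p B2p <-]; apply/s'/s; exists p => //; exact: s2.
by move=> p q /l2/l/l'.
Qed.

(* By [locally_increasing_atE], any one pair of bases in the classes suffices. *)
Definition locally_increasing_at (X Y : lospace) (f : X -> Y) (x : X) : Prop :=
  forall BB BB', bases X BB -> bases Y BB' -> locally_increasing_wrt BB BB' f x.

Lemma locally_increasing_atE (X Y : lospace) (f : X -> Y) (x : X) BB BB' :
  bases X BB -> bases Y BB' ->
  locally_increasing_at f x <-> locally_increasing_wrt BB BB' f x.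
Proof.
move=> hX hY; split=> [|H BB2 BB2' hX2 hY2]; first exact.
exact: (locally_increasing_equiv (bases_equiv hX hX2) (bases_equiv hY hY2)).
Qed.

Definition is_morphism (X Y : lospace) (f : X -> Y) : Prop :=
  forall x, locally_increasing_at f x.

Definition is_coequalizer (A X Q : lospace) (f g : A -> X) (q : X -> Q) : Prop :=
  [/\ is_morphism f, is_morphism g, is_morphism q, q \o f = q \o g &
    forall (Z : lospace) (k : X -> Z), is_morphism k -> k \o f = k \o g ->
      exists! k' : Q -> Z, is_morphism k' /\ k' \o q = k].

Program Definition prod_poset (X Y : Type) (B : poset X) (B' : poset Y) :
    poset (X * Y) :=
  @Poset (X * Y)%type (B `*` B') (fun p q => ple B p.1 q.1 /\ ple B' p.2 q.2)
    _ _ _ _.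
Next Obligation.
move=> X Y B B' [a b] [c d] [/= h h'].
by have [? ?] := ple_carrier h; have [? ?] := ple_carrier h'.
Qed.
Next Obligation. by move=> X Y B B' p [? ?]; split; exact: ple_refl. Qed.
Next Obligation.
move=> X Y B B' [a b] [c d] [/= h1 h2] [/= h3 h4].
by rewrite (ple_anti h1 h3) (ple_anti h2 h4).
Qed.
Next Obligation.
move=> X Y B B' [a b] [c d] [e f] [/= h1 h2] [/= h3 h4].
by split; [exact: ple_trans h1 h3|exact: ple_trans h2 h4].
Qed.

Definition prod_basis (X Y : Type) (BB : set (poset X)) (BB' : set (poset Y)) :
    set (poset (X * Y)) :=
  [set C | exists B B', [/\ BB B, BB' B' & C = prod_poset B B']].

Lemma lax_sub_prod (X Y : Type) (B1 B2 : poset X) (B1' B2' : poset Y) :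
  lax_sub B1 B2 -> lax_sub B1' B2' ->
  lax_sub (prod_poset B1 B1') (prod_poset B2 B2').
Proof.
move=> [s l] [s' l']; split=> [[x y] [/= ? ?]|[x y] [x' y'] [/= ? ?]].
  by split; [exact: s|exact: s'].
by split; [exact: l|exact: l'].
Qed.

Lemma basisP (X : topologicalType) (BB : set (set X)) :
  basis BB <-> (forall B, BB B -> open B) /\
    forall x U, open U -> U x -> exists B, [/\ BB B, B x & B `<=` U].
Proof.
split=> [[Bo H]|[Bo H]]; split=> //.
  move=> x U oU Ux; have [B [? ?] ?] := H x U (open_nbhs_nbhs (conj oU Ux)).
  by exists B.
move=> x U; rewrite nbhsE => -[V [oV Vx VU]].
have [B [? ? BV]] := H _ _ oV Vx.
by exists B => //; exact: subset_trans BV VU.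
Qed.

Lemma ordered_basisP (X : topologicalType) (BB : set (poset X)) :
  ordered_basis BB <-> [/\ forall B, BB B -> open B,
    forall x U, open U -> U x -> exists B, [/\ BB B, carrier B x & B `<=` U] &
  forall (x : X) (B B' : poset X), BB B -> BB B' -> carrier B x -> carrier B' x ->
    exists B'', [/\ BB B'', carrier B'' x, lax_sub B'' B & lax_sub B'' B']].
Proof.
split=> [[/basisP[Bo H] l]|[Bo H l]]; split=> //.
- by move=> B BBB; apply: Bo; exists B.
- move=> x U oU Ux; have [_ [[B BBB <-] Bx BU]] := H _ _ oU Ux.
  by exists B.
- apply/basisP; split=> [_ [B BBB <-]|x U oU Ux]; first exact: Bo.
  by have [B [? ? ?]] := H _ _ oU Ux; exists B; split=> //; exists B.
Qed.

Lemma open_setX (X Y : topologicalType) (A : set X) (B : set Y) :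
  open A -> open B -> open (A `*` B).
Proof.
move=> oA oB; rewrite openE => -[x y] [Ax By].
by exists (A, B) => //; split; apply: open_nbhs_nbhs; split.
Qed.

Lemma ordered_basis_prod (X Y : topologicalType) (BB : set (poset X))
    (BB' : set (poset Y)) :
  ordered_basis BB -> ordered_basis BB' -> ordered_basis (prod_basis BB BB').
Proof.
move=> /ordered_basisP[oX HX lX] /ordered_basisP[oY HY lY].
apply/ordered_basisP; split.
- move=> _ [B [B' [BBB BBB' ->]]].
  exact: open_setX (oX _ BBB) (oY _ BBB').
- move=> [x y] U oU Uxy.
  have [[P Q] /=] := open_nbhs_nbhs (conj oU Uxy).
  rewrite !nbhsE => -[[P' [oP' P'x PP]] [Q' [oQ' Q'y QQ]]] PQU.
  have [B [BBB Bx BP]] := HX _ _ oP' P'x.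
  have [B' [BBB' B'y BQ]] := HY _ _ oQ' Q'y.
  exists (prod_poset B B'); split=> //; first by exists B, B'.
  by move=> [a b] [/= /BP/PP Pa /BQ/QQ Qb]; apply: PQU.
- move=> [x y] _ _ [B1 [B1' [h1 h1' ->]]] [B2 [B2' [h2 h2' ->]]] /=.
  move=> [/= B1x B1y] [/= B2x B2y].
  have [B [? ? ? ?]] := lX _ _ _ h1 h2 B1x B2x.
  have [B' [? ? ? ?]] := lY _ _ _ h1' h2' B1y B2y.
  exists (prod_poset B B'); split=> //; [|exact: lax_sub_prod..].
  by exists B, B'.
Qed.

Lemma coarser_prod (X Y : Type) (BB1 BB2 : set (poset X))
    (BB1' BB2' : set (poset Y)) :
  coarser BB1 BB2 -> coarser BB1' BB2' ->
  coarser (prod_basis BB1 BB1') (prod_basis BB2 BB2').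
Proof.
move=> c c' [x y] _ [B [B' [h h' ->]]] [/= Bx B'y].
have [B2 [? ? ?]] := c _ _ h Bx.
have [B2' [? ? ?]] := c' _ _ h' B'y.
exists (prod_poset B2 B2'); split=> //; last exact: lax_sub_prod.
by exists B2, B2'.
Qed.

Section Product.
Variables X Y : lospace.

(* The class of the bases of products, see [bases_prod]. *)
Definition prod_bases : set (set (poset (X * Y))) :=
  [set CC | ordered_basis CC /\ exists BB BB',
    [/\ bases X BB, bases Y BB' & equiv_bases (prod_basis BB BB') CC]].

Lemma prod_basesP :
  exists2 CC, ordered_basis CC & prod_bases = basis_class CC.
Proof.
have [BB hBB eBB] := basesP X; have [BB' hBB' eBB'] := basesP Y.
have bX : bases X BB by rewrite eBB; split=> //; exact: equiv_bases_refl.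
have bY : bases Y BB' by rewrite eBB'; split=> //; exact: equiv_bases_refl.
exists (prod_basis BB BB'); first exact: ordered_basis_prod.
apply/seteqP; split=> CC [oCC] => [[BB1 [BB1' [h h' e]]]|e].
  split=> //; apply: equiv_bases_trans e.
  have [c1 c2] := bases_equiv bX h; have [c1' c2'] := bases_equiv bY h'.
  by split; exact: coarser_prod.
by split=> //; exists BB, BB'.
Qed.

Definition los_prod : lospace := LOSpace prod_basesP.

Lemma bases_prod BB BB' :
  bases X BB -> bases Y BB' -> bases los_prod (prod_basis BB BB').
Proof.
move=> hX hY; split.
  by apply: ordered_basis_prod; [move: hX|move: hY]; exact: bases_ordered.
by exists BB, BB'; split=> //; exact: equiv_bases_refl.
Qed.

End Product.

Program Definition eq_poset (X : Type) (U : set X) : poset X :=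
  @Poset X U (fun p q => U p /\ p = q) _ _ _ _.
Next Obligation. by move=> X U p q [Up <-]. Qed.
Next Obligation. by move=> X U p Up. Qed.
Next Obligation. by move=> X U p q [_ ->]. Qed.
Next Obligation. by move=> X U p q r [Up <-] [_ <-]; split. Qed.

Definition eq_basis (X : topologicalType) : set (poset X) :=
  [set eq_poset U | U in open].

Lemma eq_basisP (X : topologicalType) : ordered_basis (@eq_basis X).
Proof.
apply/ordered_basisP; split.
- by move=> _ [U oU <-].
- by move=> x U oU Ux; exists (eq_poset U); split=> //; exists U.
- move=> x _ _ [U oU <-] [V oV <-] /= Ux Vx.
  exists (eq_poset (U `&` V)); split=> //.
  + by exists (U `&` V) => //; exact: openI.
  + by split=> [p []|p q [[Up _] <-]] //; split.
  + by split=> [p []|p q [[_ Vp] <-]] //; split.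
Qed.

Definition los_of_top (X : topologicalType) : lospace :=
  los_of_basis (@eq_basisP X).

Section Circle.
Variable R : realType.
Implicit Types (x y z a b : R).

(* [expi x] is e^{ix}; [R[i]^o] carries the norm topology of the complex
   numbers. *)
Definition expi x : R[i]^o := cos x +i* sin x.

Definition circleQ : set R[i]^o := [set expi (ratr r) | r in [set: rat]].

Definition S1Q : topologicalType := set_type circleQ.

(* A proper open arc is represented by the endpoints of an interval of angles;
   neither the arc nor its order depends on the choice of these endpoints. *)
Definition proper_arc a b : Prop := 0 < b - a < pi *+ 2.

Definition arc a b : set R[i]^o := expi @` `]a, b[.

Definition arc_le a b (u v : R[i]^o) : Prop :=
  exists x y, [/\ x \in `]a, b[, y \in `]a, b[, u = expi x, v = expi y & x <= y].

Lemma expiD x y : expi (x + y) = expi x * expi y.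
Proof. by rewrite /expi cosD sinD; congr Complex; rewrite addrC. Qed.

Lemma expi0 : expi 0 = 1.
Proof. by rewrite /expi cos0 sin0. Qed.

Lemma expiN_eq x y : expi x = expi y -> expi (x - y) = 1.
Proof. by move=> e; rewrite expiD e -expiD subrr expi0. Qed.

Lemma expi2pi (k : int) : expi ((pi *+ 2) *~ k) = 1.
Proof.
have H (n : nat) : cos ((pi : R) *+ 2 *+ n) = 1 /\ sin ((pi : R) *+ 2 *+ n) = 0.
  by split; [have := periodicn (@cosD2pi R) n 0|have := periodicn (@sinD2pi R) n 0];
     rewrite add0r ?cos0 ?sin0.
case: k => n.
  by have [h1 h2] := H n; rewrite /expi -pmulrn h1 h2.
have [h1 h2] := H n.+1.
by rewrite /expi NegzE mulrNz -pmulrn cosN sinN h1 h2 oppr0.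
Qed.

Lemma angle_near x y : exists k : int, `|y + (pi *+ 2) *~ k - x| <= pi.
Proof.
have pi0 : 0 < (pi : R) := pi_gt0 R.
exists (- Num.floor ((y - x + pi) / (pi *+ 2))).
set f := Num.floor _; have /andP[] := floor_itv ((y - x + pi) / (pi *+ 2)).
rewrite -/f intrD => h1 h2.
have p2 : 0 < (pi : R) *+ 2 by lra.
rewrite ler_pdivlMr // in h1; rewrite ltr_pdivrMr // in h2.
rewrite mulrNz -[_ *~ f]mulrzl ler_norml; apply/andP; split; lra.
Qed.

Definition cdist (u v : R[i]) : R := complex.Re `|u - v|.

Lemma cdist_expi x y : cdist (expi x) (expi y) = 2 * `|sin ((x - y) / 2)|.
Proof.
rewrite /cdist normc_def /=.
set s := sin ((x - y) / 2).
have -> : (cos x - cos y) ^+ 2 + (sin x - sin y) ^+ 2 = (2 * s) ^+ 2.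
  have e1 : cos (x - y) = 1 - s ^+ 2 *+ 2.
    rewrite {1}(_ : x - y = ((x - y) / 2) *+ 2); last by rewrite -mulr_natr mulfVK.
    rewrite cos_mulr2n -/s; have := cos2Dsin2 ((x - y) / 2); rewrite -/s; lra.
  rewrite cosB in e1.
  have := cos2Dsin2 x; have := cos2Dsin2 y; nra.
by rewrite sqrtr_sqr normrM ger0_norm.
Qed.

Lemma cdistE (u v : R[i]) : `|u - v| = (cdist u v)%:C.
Proof. by rewrite /cdist normc_def. Qed.

Lemma cdistC (u v : R[i]) : cdist u v = cdist v u.
Proof. by rewrite /cdist distrC. Qed.

Lemma cdistuu (u : R[i]) : cdist u u = 0.
Proof. by rewrite /cdist subrr normr0. Qed.

Lemma cdist_ge0 (u v : R[i]) : 0 <= cdist u v.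
Proof. by have := normr_ge0 (u - v); rewrite cdistE ler0c. Qed.

Lemma cdist_triangle (u v w : R[i]) : cdist u w <= cdist u v + cdist v w.
Proof.
rewrite -lecR raddfD /= -!cdistE.
by rewrite (_ : u - w = (u - v) + (v - w)) ?ler_normD //; ring.
Qed.

Lemma sin_half_eq0 z : `|z| < pi *+ 2 -> sin (z / 2) = 0 -> z = 0.
Proof.
move=> hz; case: (ltrgtP z 0) => // z0 s0.
  have := @sin_gt0_pi R (- z / 2).
  rewrite mulNr sinN s0 oppr0 ltxx => /implyP; rewrite implybF => /negP[].
  by rewrite ltr0_norm // in hz; apply/andP; split; lra.
have := @sin_gt0_pi R (z / 2).
rewrite s0 ltxx => /implyP; rewrite implybF => /negP[].
by rewrite gtr0_norm // in hz; apply/andP; split; lra.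
Qed.

Lemma expi_inj x y : `|x - y| < pi *+ 2 -> expi x = expi y -> x = y.
Proof.
move=> h e; apply/eqP; rewrite -subr_eq0; apply/eqP/sin_half_eq0 => //.
have := cdist_expi x y; rewrite e cdistuu => /esym/eqP.
by rewrite mulf_eq0 pnatr_eq0 /= normr_eq0 => /eqP.
Qed.

Lemma sin_half_ge d z : 0 < d <= pi -> d <= `|z| <= pi ->
  sin (d / 2) <= `|sin (z / 2)|.
Proof.
move=> /andP[d0 dpi] /andP[dz zpi].
have pi0 : 0 < (pi : R) := pi_gt0 R.
have -> : `|sin (z / 2)| = sin (`|z| / 2).
  have s0 : 0 <= sin (`|z| / 2).
    by apply: sin_ge0_pi; apply/andP; split; lra.
  case: (ltP z 0) => z0.
    by move: s0; rewrite ltr0_norm // mulNr sinN => /ger0_norm <-; rewrite normrN.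
  by move: s0; rewrite (ger0_norm z0) => /ger0_norm.
move: dz; rewrite le_eqVlt => /orP[/eqP -> //|dz].
apply/ltW; rewrite ltr_sin ?in_itv /=; [lra|..]; apply/andP; split; lra.
Qed.

Lemma arc_small x d : 0 < d ->
  exists2 e, 0 < e & forall y, cdist (expi x) (expi y) < e ->
    exists z, `|z - x| < d /\ expi y = expi z.
Proof.
move=> d0; have pi0 : 0 < (pi : R) := pi_gt0 R.
pose d' := Num.min d pi.
have d'0 : 0 < d' by rewrite lt_min d0.
have d'd : d' <= d by rewrite ge_min lexx.
have d'pi : d' <= pi by rewrite ge_min lexx orbT.
exists (2 * sin (d' / 2)).
  by rewrite mulr_gt0 // sin_gt0_pi //; apply/andP; split; lra.
move=> y; have [k hk] := angle_near x y.
have ey : expi y = expi (y + (pi *+ 2) *~ k) by rewrite expiD expi2pi mulr1.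
rewrite ey; move: hk; set z := y + _ => hk h; exists z; split=> //.
rewrite ltNge; apply/negP => dz; move: h; rewrite cdistC cdist_expi ltr_pM2l //.
by rewrite ltNge sin_half_ge // ?d'0 // hk (le_trans d'd).
Qed.

Lemma expi_cont x e : 0 < e ->
  exists2 d, 0 < d & forall y, `|y - x| < d -> cdist (expi x) (expi y) < e.
Proof.
move=> e0.
have h : {for x, continuous (fun y => 2 * `|sin ((x - y) / 2)|)}.
  move=> /=; apply: cvgM; first exact: cvg_cst.
  apply: (@cvg_norm _ R^o).
  apply: (@continuous_comp _ _ _ (fun y : R => (x - y) / 2) (@sin R)).
    by apply: cvgM; [apply: cvgB; [exact: cvg_cst|exact: cvg_id]|exact: cvg_cst].
  exact: continuous_sin.
have /cvgrPdist_lt/(_ e e0) := h.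
rewrite subrr mul0r sin0 normr0 mulr0 => /nbhs_ballP[d /= d0 H].
exists d => // y yx; rewrite cdist_expi.
have := H y; rewrite /ball/= distrC => /(_ yx).
by rewrite sub0r normrN ger0_norm // mulr_ge0.
Qed.

Lemma nbhs_S1Q (s : S1Q) (A : set S1Q) :
  nbhs s A <-> exists2 e, 0 < e &
    forall s' : S1Q, cdist (val s) (val s') < e -> A s'.
Proof.
split.
  case=> _ [/= [V oV <-] /= Vs VA].
  have := open_nbhs_nbhs (conj oV Vs) => /nbhs_ballP[e /= e0 H].
  have eE : e = (complex.Re e)%:C by rewrite RRe_real // gtr0_real.
  exists (complex.Re e); first by rewrite -ltcR -eE.
  move=> s' h; apply: VA => /=; apply: H; rewrite /ball /=.
  by rewrite cdistE eE ltcR.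
move=> [e e0 H].
exists (set_val @^-1` (ball (set_val s : R[i]^o) e%:C)^°) => /=.
  have e0' : 0 < e%:C by rewrite ltcR.
  split=> /=; first by eexists; last reflexivity; exact: open_interior.
    exact: nbhsx_ballx.
  move=> s' /= /interior_subset; rewrite /ball /= cdistE ltcR; exact: H.
Qed.

Lemma S1Q_angle (s : S1Q) : exists r : rat, val s = expi (ratr r).
Proof. by case: s => z /= /set_mem[r _ <-]; exists r. Qed.

Lemma S1Q_rat (r : rat) : exists s : S1Q, val s = expi (ratr r).
Proof. by exists (@exist _ _ (expi (ratr r)) (mem_set (ex_intro2 _ _ r I erefl))). Qed.

Lemma arc_inE a b (u : R[i]^o) : arc a b u <-> exists2 x, a < x < b & u = expi x.
Proof.
split=> [[x /= + <-]|[x h ->]]; first by rewrite in_itv /= => h; exists x.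
by exists x => //=; rewrite in_itv.
Qed.

Lemma arc_le_inE a b u v : arc_le a b u v <->
  exists x y, [/\ a < x, x <= y, y < b, u = expi x & v = expi y].
Proof.
split.
  move=> [x [y [+ + eu ev xy]]].
  by rewrite !in_itv /= => /andP[ax xb] /andP[ay yb]; exists x, y.
move=> [x [y [ax xy yb eu ev]]]; exists x, y.
by split=> //; rewrite in_itv /=; apply/andP; split; lra.
Qed.

Lemma arc_shift x x' a b :
  expi x = expi x' -> arc (x + a) (x + b) = arc (x' + a) (x' + b).
Proof.
move=> e; suff H t t' (u : R[i]^o) :
    expi t = expi t' -> arc (t + a) (t + b) u -> arc (t' + a) (t' + b) u.
  by apply/seteqP; split=> u; exact: H.
move=> {}e /arc_inE[z h ->]; apply/arc_inE; exists (z + (t' - t)).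
  by apply/andP; move/andP: h => [? ?]; split; lra.
by rewrite expiD (expiN_eq (esym e)) mulr1.
Qed.

Lemma arc_le_shift x x' a b u v : expi x = expi x' ->
  arc_le (x + a) (x + b) u v -> arc_le (x' + a) (x' + b) u v.
Proof.
move=> e /arc_le_inE[y [z [h1 h2 h3 -> ->]]]; apply/arc_le_inE.
exists (y + (x' - x)), (z + (x' - x)); split; [lra|lra|lra|..];
  by rewrite expiD (expiN_eq (esym e)) mulr1.
Qed.

Lemma arc_sub a b a' b' : a' <= a -> b <= b' -> arc a b `<=` arc a' b'.
Proof.
move=> aa bb u /arc_inE[x /andP[? ?] ->]; apply/arc_inE; exists x => //.
by apply/andP; split; lra.
Qed.

Lemma arc_le_sub a b a' b' u v :
  a' <= a -> b <= b' -> arc_le a b u v -> arc_le a' b' u v.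
Proof.
move=> aa bb /arc_le_inE[x [y [? ? ? -> ->]]]; apply/arc_le_inE.
by exists x, y; split=> //; lra.
Qed.

Lemma arc_le_arc a b u v : arc_le a b u v -> arc a b u /\ arc a b v.
Proof.
move=> /arc_le_inE[x [y [? ? ? -> ->]]].
by split; apply/arc_inE; [exists x|exists y] => //; apply/andP; split; lra.
Qed.

Lemma arc_le_refl a b u : arc a b u -> arc_le a b u u.
Proof.
by move=> /arc_inE[x /andP[? ?] ->]; apply/arc_le_inE; exists x, x.
Qed.

Lemma arc_le_anti a b u v : proper_arc a b ->
  arc_le a b u v -> arc_le a b v u -> u = v.
Proof.
move=> /andP[_ ab] /arc_le_inE[x [y [ax xy yb -> ->]]].
move=> /arc_le_inE[y' [x' [ay' y'x' x'b ey ex]]].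
have ? : y = y' by apply: expi_inj => //; rewrite ltr_norml; apply/andP; split; lra.
have ? : x = x' by apply: expi_inj => //; rewrite ltr_norml; apply/andP; split; lra.
by congr expi; lra.
Qed.

Lemma arc_le_trans a b u v w : proper_arc a b ->
  arc_le a b u v -> arc_le a b v w -> arc_le a b u w.
Proof.
move=> /andP[_ ab] /arc_le_inE[x [y [ax xy yb -> ->]]].
move=> /arc_le_inE[y' [z [ay' y'z zb ey ->]]].
have ? : y = y' by apply: expi_inj => //; rewrite ltr_norml; apply/andP; split; lra.
by apply/arc_le_inE; exists x, z; split=> //; lra.
Qed.

Definition arcQ a b : set S1Q := [set s : S1Q | arc a b (val s)].

Program Definition arc_poset a b (ab : proper_arc a b) : poset S1Q :=
  @Poset S1Q (arcQ a b) (fun s s' => arc_le a b (val s) (val s')) _ _ _ _.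
Next Obligation. by move=> a b ab p q /arc_le_arc. Qed.
Next Obligation. by move=> a b ab p; exact: arc_le_refl. Qed.
Next Obligation. by move=> a b ab p q h1 h2; exact/val_inj/(arc_le_anti ab h1 h2). Qed.
Next Obligation. by move=> a b ab p q r; exact: arc_le_trans. Qed.

Definition arc_basis : set (poset S1Q) :=
  [set B | exists a b (ab : proper_arc a b), B = arc_poset ab].

Lemma open_arcQ a b : open (arcQ a b).
Proof.
rewrite openE => s /arc_inE[x /andP[ax xb] es]; apply/nbhs_S1Q.
have d0 : 0 < Num.min (x - a) (b - x) by rewrite lt_min; apply/andP; split; lra.
have [e e0 H] := arc_small x d0; exists e => // s'.
have [r er] := S1Q_angle s'; rewrite es er => /H[z [hz ez]].
apply/arc_inE; exists z; last by rewrite er.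
by move: hz; rewrite lt_min ltr_norml ltr_norml => /andP[/andP[? ?] /andP[? ?]];
   apply/andP; split; lra.
Qed.

Lemma arcQ_nbhs (s : S1Q) x (A : set S1Q) : val s = expi x -> nbhs s A ->
  exists2 d, 0 < d & arcQ (x - d) (x + d) `<=` A.
Proof.
move=> es /nbhs_S1Q[e e0 H]; have [d d0 H'] := expi_cont x e0.
exists d => // s' /arc_inE[z /andP[? ?] ez]; apply: H; rewrite es ez.
by apply: H'; rewrite ltr_norml; apply/andP; split; lra.
Qed.

Lemma arcQ_center (s : S1Q) x d : val s = expi x -> 0 < d ->
  arcQ (x - d) (x + d) s.
Proof. by move=> es d0; apply/arc_inE; exists x => //; apply/andP; split; lra. Qed.

Lemma proper_arc_center x d : 0 < d <= 1 -> proper_arc (x - d) (x + d).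
Proof.
move=> /andP[d0 d1]; have := pi_ge2 R => pi2.
by apply/andP; split; lra.
Qed.

Lemma arc_local (s : S1Q) x a b : val s = expi x -> arcQ a b s ->
  exists2 d0, 0 < d0 & forall d, 0 < d <= d0 ->
    arc (x - d) (x + d) `<=` arc a b /\
    forall u v, arc_le (x - d) (x + d) u v -> arc_le a b u v.
Proof.
move=> es /arc_inE[x' /andP[ax xb] es'].
exists (Num.min (x' - a) (b - x')); first by rewrite lt_min; apply/andP; split; lra.
move=> d /andP[d0]; rewrite le_min => /andP[? ?].
have e : expi x = expi x' by rewrite -es -es'.
split; first by rewrite (arc_shift (- d) d e); apply: arc_sub; lra.
by move=> u v /(arc_le_shift e); apply: arc_le_sub; lra.
Qed.

Lemma arc_basisP : ordered_basis arc_basis.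
Proof.
apply/ordered_basisP; split.
- by move=> _ [a [b [ab ->]]]; exact: open_arcQ.
- move=> s U oU Us; have [r er] := S1Q_angle s.
  have [d d0 H] := arcQ_nbhs er (open_nbhs_nbhs (conj oU Us)).
  have h : 0 < Num.min d 1 <= 1 by rewrite lt_min d0 ltr01 ge_min lexx orbT.
  exists (arc_poset (proper_arc_center (ratr r) h)); split.
  + by do 3 eexists.
  + by apply: arcQ_center => //; case/andP: h.
  + apply: subset_trans H => s'; apply: arc_sub; have : Num.min d 1 <= d by rewrite ge_min lexx.
      lra.
    lra.
- move=> s _ _ [a [b [ab ->]]] [a' [b' [ab' ->]]] /= h h'.
  have [r er] := S1Q_angle s.
  have [d d0 H] := arc_local er h; have [d' d0' H'] := arc_local er h'.
  pose e := Num.min (Num.min d d') 1.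
  have e0 : 0 < e by rewrite !lt_min d0 d0' ltr01.
  have ed : e <= d by rewrite !ge_min lexx.
  have ed' : e <= d' by rewrite !ge_min lexx orbT.
  have e1 : 0 < e <= 1 by rewrite e0 ge_min lexx orbT.
  exists (arc_poset (proper_arc_center (ratr r) e1)); split.
  + by do 3 eexists.
  + exact: arcQ_center.
  + have [|S L] := H e; first by rewrite e0.
    by split=> [s' /S//|p q /L].
  + have [|S L] := H' e; first by rewrite e0.
    by split=> [s' /S//|p q /L].
Qed.

End Circle.

Section DefW.
Variable R : realType.
Local Notation S1Q := (S1Q R).

Definition unitI : topologicalType := set_type (`[0, 1]%classic : set R).

Definition unitIoc : choiceType := set_type (`]0, 1]%classic : set R).

(* [None] is the point 0. *)
Definition Wspace : Type := option (S1Q * unitIoc).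

HB.instance Definition _ := Choice.on Wspace.

Definition Wq (p : S1Q * unitI) : Wspace := omap (pair p.1) (insub (val p.2)).

(* The final topology of [Wq]. *)
Definition Wopen : set (set Wspace) := [set U | open (Wq @^-1` U)].

Lemma WopenT : Wopen setT.
Proof. by rewrite /Wopen /= preimage_setT; exact: openT. Qed.

Lemma WopenI : setI_closed Wopen.
Proof. by move=> A B oA oB; rewrite /Wopen /= preimage_setI; exact: openI. Qed.

Lemma Wopen_bigcup (I : Type) (f : I -> set Wspace) :
  (forall i, Wopen (f i)) -> Wopen (\bigcup_i f i).
Proof.
move=> oF; rewrite /Wopen /= preimage_bigcup.
by apply: bigcup_open => i _; exact: oF.
Qed.

HB.instance Definition _ :=
  isOpenTopological.Build Wspace WopenT WopenI Wopen_bigcup.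

Definition W_H : set (S1Q -> R) :=
  [set h : S1Q -> R | [/\ continuous h, forall s, 0 < h s <= 1 & inf (range h) = 0]].

Definition W_O (h : S1Q -> R) : set Wspace :=
  [set w | if w is Some (s, t) then val t < h s else True].

Definition W_O_le (h : S1Q -> R) (w w' : Wspace) : Prop :=
  match w, w' with
  | None, None => True
  | Some (s, t), Some (s', t') => t = t' /\ exists a b, [/\ proper_arc a b,
      arc_le a b (val s) (val s') & [set Some (u, t) | u in arcQ a b] `<=` W_O h]
  | _, _ => False
  end.

Definition W_box (a b c d : R) : set Wspace :=
  [set w | if w is Some (s, t) then arcQ a b s /\ c < val t < d else False].

Definition W_box_le (a b c d : R) (w w' : Wspace) : Prop :=
  match w, w' with
  | Some (s, t), Some (s', t') =>
      [/\ arc_le a b (val s) (val s'), t = t' & c < val t < d]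
  | _, _ => False
  end.

Lemma I_bounds (t : unitI) : 0 <= val t <= 1.
Proof. by case: t => t /= /set_mem; rewrite /= in_itv. Qed.

Lemma Ioc_bounds (t : unitIoc) : 0 < val t <= 1.
Proof. by case: t => t /= /set_mem; rewrite /= in_itv. Qed.

Lemma I_mk x : 0 <= x <= 1 -> exists t : unitI, val t = x.
Proof.
move=> h; have h' : `[0, 1]%classic x by rewrite /= in_itv.
by exists (@exist _ _ x (mem_set h')).
Qed.

Lemma Ioc_mk x : 0 < x <= 1 -> exists t : unitIoc, val t = x.
Proof.
move=> h; have h' : `]0, 1]%classic x by rewrite /= in_itv.
by exists (@exist _ _ x (mem_set h')).
Qed.

Lemma Wq0 (s : S1Q) (t : unitI) : val t = 0 -> Wq (s, t) = None.
Proof.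
move=> t0; rewrite /Wq /= insubF //; apply/negbTE/negP => /set_mem /=.
by rewrite in_itv /= t0 ltxx.
Qed.

Lemma WqS (s : S1Q) (t : unitI) (t' : unitIoc) :
  val t = val t' -> Wq (s, t) = Some (s, t').
Proof. by move=> e; rewrite /Wq /= e valK. Qed.

Lemma nbhs_I (t : unitI) (A : set unitI) :
  nbhs t A <-> exists2 e, 0 < e & forall t' : unitI, `|val t - val t'| < e -> A t'.
Proof.
split.
  case=> _ [/= [V oV <-] /= Vs VA].
  have := open_nbhs_nbhs (conj oV Vs) => /nbhs_ballP[e /= e0 H].
  by exists e => // t' h; apply: VA; exact: H.
move=> [e e0 H].
exists (set_val @^-1` (ball (set_val t : R) e)^°) => /=.
  split=> /=; first by eexists; last reflexivity; exact: open_interior.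
    exact: nbhsx_ballx.
  move=> s' /= /interior_subset; exact: H.
Qed.

Lemma W_nbhs_some (s : S1Q) (t : unitIoc) x (U : set Wspace) :
  val s = expi x -> open U -> U (Some (s, t)) ->
  exists2 e, 0 < e & forall s' (t' : unitIoc),
    arcQ (x - e) (x + e) s' -> `|val t - val t'| < e -> U (Some (s', t')).
Proof.
move=> es oU Ust; have /andP[t0 t1] := Ioc_bounds t.
have [|ti eti] := @I_mk (val t); first by rewrite (ltW t0).
have Vst : (Wq @^-1` U) (s, ti) by rewrite /= (WqS _ eti).
have [[P Q] [/= nP nQ] PQ] := open_nbhs_nbhs (conj (oU : open (Wq @^-1` U)) Vst).
have [d d0 HP] := arcQ_nbhs es nP; have [e e0 HQ] := (nbhs_I _ _).1 nQ.
exists (Num.min d e); first by rewrite lt_min d0.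
move=> s' t' hs'; rewrite lt_min => /andP[_ ht'].
have /andP[t'0 t'1] := Ioc_bounds t'.
have [|ti' eti'] := @I_mk (val t'); first by rewrite (ltW t'0).
rewrite -(WqS s' eti'); apply: PQ; split=> /=.
  apply: HP; apply: arc_sub hs'; have : Num.min d e <= d by rewrite ge_min lexx.
    lra.
  lra.
by apply: HQ; rewrite eti eti'.
Qed.

Lemma W_nbhs0 (U : set Wspace) (s : S1Q) : open U -> U None ->
  exists2 e, 0 < e & forall (s' : S1Q) (t' : unitIoc),
    cdist (val s) (val s') < e -> val t' < e -> U (Some (s', t')).
Proof.
move=> oU U0.
have [|ti eti] := @I_mk 0; first by rewrite lexx ler01.
have Vst : (Wq @^-1` U) (s, ti) by rewrite /= Wq0.
have [[P Q] [/= nP nQ] PQ] := open_nbhs_nbhs (conj (oU : open (Wq @^-1` U)) Vst).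
have [d d0 HP] := (nbhs_S1Q _ _).1 nP; have [e e0 HQ] := (nbhs_I _ _).1 nQ.
exists (Num.min d e); first by rewrite lt_min d0.
move=> s' t'; rewrite !lt_min => /andP[hs' _] /andP[_ ht'].
have /andP[t'0 t'1] := Ioc_bounds t'.
have [|ti' eti'] := @I_mk (val t'); first by rewrite (ltW t'0).
rewrite -(WqS s' eti'); apply: PQ; split=> /=; first exact: HP.
by apply: HQ; rewrite eti eti' sub0r normrN gtr0_norm.
Qed.

Lemma W_HP (h : S1Q -> R) : continuous h -> (forall s, 0 < h s <= 1) ->
  W_H h <-> forall e, 0 < e -> exists s, h s < e.
Proof.
move=> hc hb.
have [s0 _] := S1Q_rat R 0.
have ne : range h !=set0 by exists (h s0), s0.
have lb0 : lbound (range h) 0 by move=> _ [s _ <-]; case/andP: (hb s) => /ltW.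
have lb : has_lbound (range h) by exists 0.
split=> [[_ _ h0] e e0|H].
  have [_ [s _ <-]] := inf_adherent e0 (conj ne lb).
  by rewrite h0 add0r; exists s.
split=> //; apply/eqP; rewrite eq_le; apply/andP; split.
  apply/ler_addgt0Pr => e /H[s /ltW he]; rewrite add0r.
  by apply: le_trans he; apply: ge_inf => //; exists s.
exact: lb_le_inf.
Qed.

(* A function in [W_H] takes values below any positive level, hence the whole
   circle at a given positive height is not contained in [W_O h]. *)
Lemma W_O_level (h : S1Q -> R) (t : unitIoc) x z : W_H h -> x + pi *+ 2 <= z ->
  (forall (u : S1Q) y, val u = expi y -> x <= y <= z -> val t < h u) -> False.
Proof.
move=> Hh xz H; case: (Hh) => hc hb _.
have /andP[t0 _] := Ioc_bounds t.
have [u hu] := (W_HP hc hb).1 Hh _ t0.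
have [r er] := S1Q_angle u.
have [k] := angle_near (x + pi) (ratr r); rewrite ler_norml => /andP[h1 h2].
have := H u (ratr r + (pi *+ 2) *~ k).
rewrite expiD expi2pi mulr1 => /(_ er).
have -> : x <= ratr r + pi *+ 2 *~ k <= z by apply/andP; split; lra.
by move=> /(_ isT); rewrite ltNge (ltW hu).
Qed.

Lemma W_O_le_angles (h : S1Q -> R) (s s' s'' : S1Q) (t : unitIoc) : W_H h ->
  W_O_le h (Some (s, t)) (Some (s', t)) ->
  W_O_le h (Some (s', t)) (Some (s'', t)) ->
  exists x y z a b, [/\ [/\ val s = expi x, val s' = expi y & val s'' = expi z],
    [/\ a < x, x <= y, y <= z & z < b], z < x + pi *+ 2 &
    forall (u : S1Q) w, val u = expi w -> a < w < b -> val t < h u].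
Proof.
move=> Hh [_ [a [b [pab /arc_le_inE[x [y [ax xy yb es es']]] Hab]]]].
move=> [_ [a' [b' [pab' /arc_le_inE[y' [z [ay' yz zb es1 es'']]] Hab']]]].
have e : expi (y - y') = 1 by apply: expiN_eq; rewrite -es' -es1.
pose z1 := z + (y - y'); pose b1 := b' + (y - y').
have ez : val s'' = expi z1 by rewrite expiD e mulr1.
have K (u : S1Q) w : val u = expi w -> a < w < b1 -> val t < h u.
  move=> eu /andP[aw wb].
  have [wb0|bw] := ltP w b.
    by apply: (Hab (Some (u, t))); exists u => //; apply/arc_inE; exists w; rewrite // aw.
  apply: (Hab' (Some (u, t))); exists u => //; apply/arc_inE; exists (w - (y - y')).
    by move: wb; rewrite /b1 => wb; apply/andP; split; lra.
  have e' : expi (y' - y) = 1 by apply: expiN_eq; rewrite -es' -es1.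
  by rewrite (_ : w - (y - y') = w + (y' - y)); [rewrite expiD e' mulr1|lra].
exists x, y, z1, a, b1; split=> //; first by rewrite /z1 /b1; split; lra.
rewrite ltNge; apply/negP => hz; apply: (W_O_level (t := t) Hh hz) => u w eu /andP[xw wz].
by apply: K eu _; rewrite /b1; move: wz; rewrite /z1 => wz; apply/andP; split; lra.
Qed.

Program Definition W_O_poset (h : S1Q -> R) (Hh : W_H h) : poset Wspace :=
  @Poset Wspace (W_O h) (W_O_le h) _ _ _ _.
Next Obligation.
move=> h Hh [[s t]|] [[s' t']|] //= [<- [a [b [pab /arc_le_arc[sa s'a] H]]]].
split; first by apply: (H (Some (s, t))); exists s.
by apply: (H (Some (s', t))); exists s'.
Qed.
Next Obligation.
move=> h Hh [[s t]|] //= ths; split=> //; have [hc _ _] := Hh.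
have [r er] := S1Q_angle s.
have nA : nbhs s (h @^-1` [set y | val t < y]).
  by apply: hc; apply: open_nbhs_nbhs; split=> //; exact: open_gt.
have [d d0 H] := arcQ_nbhs er nA.
have h1 : 0 < Num.min d 1 <= 1 by rewrite lt_min d0 ltr01 ge_min lexx orbT.
exists (ratr r - Num.min d 1), (ratr r + Num.min d 1); split.
- exact: proper_arc_center.
- by apply: arc_le_refl; apply: arcQ_center => //; case/andP: h1.
- move=> _ [u hu <-] /=; apply: H; apply: arc_sub hu;
    have : Num.min d 1 <= d by rewrite ge_min lexx.
    lra.
  lra.
Qed.
Next Obligation.
move=> h Hh [[s t]|] [[s' t']|] // [<- h1] [_ h2].
have := W_O_le_angles Hh (conj erefl h1) (conj erefl h2).
move=> [x [y [z [a [b [[es es' es2] [ax xy yz zb] zx _]]]]]].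
have xz : x = z.
  apply: expi_inj; last by rewrite -es es2.
  by rewrite ltr_norml; apply/andP; split; lra.
have -> // : s = s'; apply: val_inj.
by rewrite [LHS]es [RHS]es'; congr expi; lra.
Qed.
Next Obligation.
move=> h Hh [[s t]|] [[s' t']|] [[s'' t'']|] // [<- h1] [<- h2]; split=> //.
have := W_O_le_angles Hh (conj erefl h1) (conj erefl h2).
move=> [x [y [z [a [b [[es es' es2] [ax xy yz zb] zx K]]]]]].
pose e := (x + pi *+ 2 - z) / 4.
have e0 : 0 < e by rewrite /e; lra.
exists (Num.max a (x - e)), (Num.min b (z + e)); split.
- have : x - e <= Num.max a (x - e) by rewrite le_max lexx orbT.
  have : Num.min b (z + e) <= z + e by rewrite ge_min lexx orbT.
  have : Num.max a (x - e) < x by rewrite gt_max ax /=; lra.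
  have : z < Num.min b (z + e) by rewrite lt_min zb /=; lra.
  by rewrite /e => ? ? ? ?; apply/andP; split; lra.
- apply/arc_le_inE; exists x, z; split=> //; last 1 first.
  + by rewrite lt_min zb /=; lra.
  + by rewrite gt_max ax /=; lra.
  + lra.
- move=> _ [u /arc_inE[w /andP[h3 h4] eu] <-]; apply: K eu _.
  by move: h3 h4; rewrite gt_max lt_min => /andP[-> _] /andP[-> _].
Qed.

Program Definition W_box_poset (a b c d : R) (ab : proper_arc a b) :
    poset Wspace :=
  @Poset Wspace (W_box a b c d) (W_box_le a b c d) _ _ _ _.
Next Obligation.
by move=> a b c d ab [[s t]|] [[s' t']|] //= [/arc_le_arc[? ?] <- ?].
Qed.
Next Obligation.
by move=> a b c d ab [[s t]|] //= [? ?]; split=> //; exact: arc_le_refl.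
Qed.
Next Obligation.
move=> a b c d ab [[s t]|] [[s' t']|] //= [h1 <- _] [h2 _ _].
by have -> // : s = s'; exact/val_inj/(arc_le_anti ab h1 h2).
Qed.
Next Obligation.
move=> a b c d ab [[s t]|] [[s' t']|] [[s'' t'']|] //= [h1 <- ?] [h2 <- _].
by split=> //; exact: arc_le_trans h1 h2.
Qed.

Definition W_basis : set (poset Wspace) :=
  [set B | exists h (Hh : W_H h), B = W_O_poset Hh] `|`
  [set B | exists a b c d (ab : proper_arc a b),
    0 < c < d /\ B = W_box_poset c d ab].

Lemma open_W_O h : W_H h -> open (W_O h : set Wspace).
Proof.
move=> [hc hb _]; rewrite /open /= /Wopen /=.
have -> : Wq @^-1` W_O h = [set p | (val p.2 : R) < h p.1].
  apply/seteqP; split=> -[s t] /=; have /andP[t0 t1] := I_bounds t;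
    have /andP[h0 h1] := hb s.
    move: t0; rewrite le_eqVlt => /orP[/eqP <-//|t0].
    by have [|t' et'] := @Ioc_mk (val t); rewrite ?t0 // (WqS s (esym et')) /= et'.
  move: t0; rewrite le_eqVlt => /orP[/eqP e0|t0]; first by rewrite Wq0.
  by have [|t' et'] := @Ioc_mk (val t); rewrite ?t0 // (WqS s (esym et')) /= et'.
rewrite openE => -[s t] th0; have th : val t < h s := th0.
pose e := (h s - val t) / 2; have e0 : 0 < e by rewrite /e; lra.
have nA : nbhs s (h @^-1` [set y | val t + e < y]).
  apply: hc; apply: open_nbhs_nbhs; split; first exact: open_gt.
  by have : val t + e < h s by rewrite /e; lra.
exists (h @^-1` [set y | val t + e < y], [set t' | val t' < val t + e]).
  split=> //; apply/nbhs_I; exists e => // t'; rewrite ltr_norml => /andP[? ?].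
  by have : val t' < val t + e by lra.
by move=> [s' t'] [h1 h2]; exact: lt_trans h2 h1.
Qed.

Lemma open_W_box a b c d : 0 < c -> open (W_box a b c d : set Wspace).
Proof.
move=> c0; rewrite /open /= /Wopen /=.
have -> : Wq @^-1` W_box a b c d = arcQ a b `*` [set t | c < val t < d].
  apply/seteqP; split=> -[s t] /=; have /andP[t0 t1] := I_bounds t;
    (move: t0; rewrite le_eqVlt => /orP[/eqP e0|t0];
      [rewrite Wq0 // -?e0 |
       have [|t' et'] := @Ioc_mk (val t); rewrite ?t0 // (WqS s (esym et')) /= et' //]).
  by case=> _ /= /andP[] *; lra.
apply: open_setX; first exact: open_arcQ.
rewrite openE => t /andP[ct td]; apply/nbhs_I.
exists (Num.min (val t - c) (d - val t)); first by rewrite lt_min; apply/andP; split; lra.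
by move=> t'; rewrite lt_min !ltr_norml => /andP[/andP[? ?] /andP[? ?]];
   apply/andP; split; lra.
Qed.

Lemma W_basis_local (s : S1Q) (t : unitIoc) x (B : poset Wspace) :
  val s = expi x -> W_basis B -> carrier B (Some (s, t)) ->
  exists2 e0, 0 < e0 & forall e (e1 : 0 < e <= 1), e <= e0 ->
    lax_sub (W_box_poset (val t - e) (val t + e) (proper_arc_center x e1)) B.
Proof.
move=> es [[h [Hh ->]] ths|[a [b [c [d [ab [/andP[c0 cd] ->]]]]]] [sab /andP[ct td]]].
  have [e0 e00 H] := W_nbhs_some es (open_W_O Hh) ths.
  exists e0 => // e e1 ee0; have /andP[e_gt0 _] := e1.
  have K (u : S1Q) (t' : unitIoc) : arcQ (x - e) (x + e) u ->
      val t - e < val t' < val t + e -> W_O h (Some (u, t')).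
    move=> hu /andP[? ?]; apply: H; first by apply: arc_sub hu; lra.
    by rewrite ltr_norml; apply/andP; split; lra.
  split=> [[[u t']|] //= [hu ht']|[[u t']|] [[u' t'']|] //= [huu' <- ht']].
    exact: (K u t').
  split=> //; exists (x - e), (x + e); split=> //.
    exact: proper_arc_center.
  by move=> _ [v hv <-]; exact: K.
have [d0 d00 H] := arc_local es sab.
exists (Num.min d0 (Num.min (val t - c) (d - val t))).
  by rewrite !lt_min d00 andTb; apply/andP; split; lra.
move=> e e1; rewrite !le_min => /andP[ed0 /andP[? ?]]; have /andP[e_gt0 _] := e1.
have [|S L] := H e; first by rewrite e_gt0.
split=> [[[u t']|] // [hu /andP[? ?]]|[[u t']|] [[u' t'']|] // [huu' <- /andP[? ?]]].
  by split; [exact: S|apply/andP; split; lra].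
by split; [exact: L| |apply/andP; split; lra].
Qed.

Lemma W_H_min h h' : W_H h -> W_H h' -> W_H (h \min h').
Proof.
move=> Hh Hh'; have [hc hb _] := Hh; have [hc' hb' _] := Hh'.
apply/W_HP.
- by move=> s; apply: (@continuous_min R _ h h' s); [exact: hc|exact: hc'].
- move=> s /=; have /andP[? ?] := hb s; have /andP[? ?] := hb' s.
  by rewrite lt_min ge_min; apply/andP; split; [apply/andP; split|apply/orP; left].
- move=> e /((W_HP hc hb).1 Hh)[s hs]; exists s => /=.
  by rewrite gt_min hs.
Qed.

Lemma W_O_lax h h' (Hh : W_H h) (Hh' : W_H h') : (forall s, h s <= h' s) ->
  lax_sub (W_O_poset Hh) (W_O_poset Hh').
Proof.
move=> hh'.
have K : W_O h `<=` W_O h' by move=> [[s t]|] //= /lt_le_trans; apply.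
split=> // [[[s t]|] [[s' t']|]] //= [<- [a [b [ab l H]]]]; split=> //.
by exists a, b; split=> //; exact: subset_trans H K.
Qed.

Lemma cont_dist (T : topologicalType) (f : T -> R) :
  (forall s e, 0 < e -> nbhs s [set s' | `|f s - f s'| < e]) -> continuous f.
Proof. by move=> H s; apply/cvgrPdist_lt => e e0; exact: H. Qed.

Lemma lipschitz_cont (f : S1Q -> R) :
  (forall s s', f s <= f s' + cdist (val s) (val s')) -> continuous f.
Proof.
move=> H; apply: cont_dist => s e e0; apply/nbhs_S1Q; exists e => // s' hs'.
have := H s s'; have := H s' s; rewrite (cdistC (val s')) => h1 h2.
by rewrite /= ltr_norml; apply/andP; split; lra.
Qed.

Lemma S1Q_hole (s : S1Q) : val s <> expi pi.
Proof.
have [r ->] := S1Q_angle s => /esym/expiN_eq e.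
have pi0 : 0 < (pi : R) := pi_gt0 R.
have [k hk] := @angle_near R 0 (pi - ratr r).
have ek : pi - ratr r + (pi *+ 2) *~ k = 0 :> R.
  apply: expi_inj; last by rewrite expiD e expi2pi mulr1 expi0.
  by apply: le_lt_trans hk _; lra.
suff : rational (pi : R) by exact: pi_irrationnal.
apply/rationalP.
pose m : int := 1 + k *+ 2.
have er : pi * m%:~R = ratr r :> R.
  by rewrite /m intrD mulrDr mulr1 -[k *+ 2]mulr_natr intrM; move: ek; rewrite -[_ *~ k]mulrzr; lra.
have m0 : m != 0 by rewrite /m mulr2n; apply/eqP; lia.
have m0' : (m%:~R : R) != 0 by rewrite intr_eq0.
have epi : pi = ratr (r / m%:~R) :> R.
  by rewrite rmorphM fmorphV /= ratr_int -er mulfK.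
exists (numq (r / m%:~R)), `|denq (r / m%:~R)|%N.
by rewrite natr_absz gtr0_norm ?denq_gt0.
Qed.

Section Height.
Variable U : set Wspace.
Hypotheses (oU : open U) (U0 : U None).

Definition heights (s : S1Q) : set R :=
  [set r | 0 <= r <= 1 /\ forall (s' : S1Q) (t' : unitIoc),
    cdist (val s) (val s') < r -> val t' < r -> U (Some (s', t'))].

Definition height s := sup (heights s).

Lemma heights0 s : heights s 0.
Proof.
split; first by rewrite lexx ler01.
by move=> s' t'; have := cdist_ge0 (val s) (val s'); rewrite leNgt => /negbTE ->.
Qed.

Lemma heights_ub s : has_ubound (heights s).
Proof. by exists 1 => r [/andP[]]. Qed.

Lemma height_ge0 s : 0 <= height s.
Proof. by apply: ub_le_sup; [exact: heights_ub|exact: heights0]. Qed.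

Lemma height_le1 s : height s <= 1.
Proof. by apply: ge_sup; [exists 0; exact: heights0|move=> r [/andP[]]]. Qed.

Lemma height_gt0 s : 0 < height s.
Proof.
have [e e0 H] := W_nbhs0 s oU U0.
apply: (@lt_le_trans _ _ (Num.min e 1)); first by rewrite lt_min e0 ltr01.
apply: ub_le_sup; first exact: heights_ub.
split; first by rewrite le_min ltW //= ler01 ge_min lexx orbT.
by move=> s' t'; rewrite !lt_min => /andP[? _] /andP[? _]; exact: H.
Qed.

Lemma height_lip s s' : height s <= height s' + cdist (val s) (val s').
Proof.
apply: ge_sup; first by exists 0; exact: heights0.
move=> r [/andP[r0 r1] H]; rewrite -lerBlDr.
have [h|h] := leP (r - cdist (val s) (val s')) 0.
  exact: le_trans h (height_ge0 _).
apply: ub_le_sup; first exact: heights_ub.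
have d0 := cdist_ge0 (val s) (val s').
split; first by apply/andP; split; lra.
move=> u t hu ht; apply: H; last by lra.
by apply: le_lt_trans (cdist_triangle _ (val s') _) _; lra.
Qed.

Lemma height_sub s (t : unitIoc) : val t < height s -> U (Some (s, t)).
Proof.
move=> /sup_gt[|r [_ H] tr]; first by exists 0; exact: heights0.
by apply: H => //; rewrite cdistuu; have /andP[t0 _] := Ioc_bounds t; lra.
Qed.

(* The second factor forces the infimum to be 0. *)
Definition heightH s := height s * (cdist (val s) (expi pi) / 2).

Lemma cdist_hole (s : S1Q) : 0 < cdist (val s) (expi pi) / 2 <= 1.
Proof.
have [r er] := S1Q_angle s.
apply/andP; split.
  rewrite divr_gt0 // lt_neqAle cdist_ge0 andbT eq_sym; apply/eqP => d0.
  apply: (@S1Q_hole s); apply/eqP; rewrite -subr_eq0 -normr_eq0.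
  by rewrite cdistE d0.
by rewrite er cdist_expi (mulrC 2) mulfK ?pnatr_eq0 // sin_max.
Qed.

Lemma heightH_W_H : W_H heightH.
Proof.
apply/W_HP.
- move=> s; apply: (@continuousM R S1Q); first exact: (lipschitz_cont height_lip).
  apply: (@continuousM R S1Q); last exact: cst_continuous.
  apply: (@lipschitz_cont (fun s : S1Q => cdist (val s) (expi pi))) => {}s s'.
  by rewrite addrC; exact: cdist_triangle.
- move=> s; rewrite /heightH; have /andP[h1 h2] := cdist_hole s.
  rewrite mulr_gt0 ?height_gt0 //= mulr_ile1 ?height_ge0 ?height_le1 //.
  exact: ltW.
- move=> e e0; have [d d0 H] := expi_cont (pi : R) e0.
  have [|r hr] := @rat_in_itvoo R (pi - d) (pi + d); first by lra.
  have [s es] := S1Q_rat R r; exists s.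
  have /andP[h1 h2] := cdist_hole s.
  have : cdist (val s) (expi pi) < e.
    rewrite es cdistC; apply: H; move: hr; rewrite in_itv /= => /andP[? ?].
    by rewrite ltr_norml; apply/andP; split; lra.
  have := height_le1 s; have := height_ge0 s; rewrite /heightH; nra.
Qed.

Lemma heightH_sub : W_O heightH `<=` U.
Proof.
move=> [[s t]|] //= h; apply: height_sub; apply: lt_le_trans h _.
rewrite /heightH -[leRHS]mulr1 ler_wpM2l ?height_ge0 //.
by case/andP: (cdist_hole s).
Qed.

End Height.

Lemma W_basisP : ordered_basis W_basis.
Proof.
have small (s : S1Q) (t : unitIoc) e0 : 0 < e0 ->
    exists e, [/\ 0 < e <= 1, e <= e0 & 0 < val t - e].
  move=> e00; have /andP[t0 t1] := Ioc_bounds t.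
  exists (Num.min e0 (val t / 2)); split; [|by rewrite ge_min lexx|].
    apply/andP; split; first by rewrite lt_min e00 andTb; lra.
    by rewrite ge_min; apply/orP; right; lra.
  have : Num.min e0 (val t / 2) <= val t / 2 by rewrite ge_min lexx orbT.
  lra.
have boxP (s : S1Q) (t : unitIoc) x e (e1 : 0 < e <= 1) : val s = expi x ->
    0 < val t - e ->
    W_basis (W_box_poset (val t - e) (val t + e) (proper_arc_center x e1)) /\
    carrier (W_box_poset (val t - e) (val t + e) (proper_arc_center x e1))
      (Some (s, t)).
  move=> es te; have /andP[e0 _] := e1; split.
    right; do 5 eexists; split; last reflexivity.
    by rewrite te andTb; lra.
  split; first exact: arcQ_center.
  by apply/andP; split; lra.
apply/ordered_basisP; split.
- move=> _ [[h [Hh ->]]|[a [b [c [d [ab [/andP[c0 cd] ->]]]]]]].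
    exact: open_W_O.
  exact: open_W_box.
- move=> [[s t]|] U oU Ux.
    have [r er] := S1Q_angle s; have [e0 e00 H] := W_nbhs_some er oU Ux.
    have [e [e1 ee0 te]] := small s t e0 e00; have [h1 h2] := boxP _ _ _ _ e1 er te.
    eexists; split; [exact: h1|exact: h2|].
    move=> [[u t']|] // [hu /andP[? ?]]; apply: H; first by apply: arc_sub hu; lra.
    by rewrite ltr_norml; apply/andP; split; lra.
  exists (W_O_poset (heightH_W_H oU Ux)); split=> //; last exact: heightH_sub.
  by left; do 2 eexists.
- move=> [[s t]|] B B' hB hB' Bx B'x.
    have [r er] := S1Q_angle s.
    have [e0 e00 H] := W_basis_local er hB Bx.
    have [e0' e00' H'] := W_basis_local er hB' B'x.
    have [|e [e1 ee0 te]] := small s t (Num.min e0 e0'); first by rewrite lt_min e00.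
    move: ee0; rewrite le_min => /andP[ee0 ee0'].
    have [h1 h2] := boxP _ _ _ _ e1 er te.
    by eexists; split; [exact: h1|exact: h2|exact: H|exact: H'].
  case: hB Bx => [[h [Hh ->]] _|[a [b [c [d [ab [_ ->]]]]]] //].
  case: hB' B'x => [[h' [Hh' ->]] _|[a [b [c [d [ab [_ ->]]]]]] //].
  exists (W_O_poset (W_H_min Hh Hh')); split=> //.
  + by left; do 2 eexists.
  + by apply: W_O_lax => s; rewrite /= ge_min lexx.
  + by apply: W_O_lax => s; rewrite /= ge_min lexx orbT.
Qed.

Definition S1Q_los : lospace := los_of_top S1Q.

Definition dS1Q_los : lospace := los_of_basis (@arc_basisP R).

Definition unitI_los : lospace := los_of_top unitI.

Definition W_los : lospace := los_of_basis W_basisP.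

Lemma I_zero : `[0, 1]%classic (0 : R).
Proof. by rewrite /= in_itv /= lexx ler01. Qed.

Definition I0 : unitI := exist _ (0 : R) (mem_set I_zero).

Lemma circleQ_one : circleQ (1 : R[i]^o).
Proof. by exists 0 => //; rewrite raddf0 expi0. Qed.

Definition S1Q1 : S1Q := exist _ (1 : R[i]^o) (mem_set circleQ_one).

Definition i0 : S1Q_los -> los_prod dS1Q_los unitI_los := fun s => (s, I0).

Definition c0 : S1Q_los -> los_prod dS1Q_los unitI_los := fun _ => (S1Q1, I0).

Definition q : los_prod dS1Q_los unitI_los -> W_los := Wq.

End DefW.

(* Main.v *)
Require Import Defs.
From mathcomp Require Import all_boot all_order all_algebra.
From mathcomp Require Import all_classical all_reals all_analysis.
From mathcomp Require Import complex lra.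

(** The map [q] collapses the bottom circle and nothing else, so a morphism [k]
    that is constant on the bottom circle descends to exactly one map on [W],
    namely [k] composed with a section of [q]. Away from the apex [q] is a local
    isomorphism and the descended map is a morphism there because [k] is. All
    the content is at the apex.

    Let [C] be an ordered neighbourhood in [Z] of the common value of [k] on the
    bottom circle. Every rational point [s] has a small arc and a small height
    below which [k] is increasing into [C]. We need a single [h] such that [k]
    is increasing along every arc contained in a horizontal slice of [O_h], and
    it does not suffice that each point of the slice has some arc on which [k]
    is increasing: these arcs are centred at rational points, they may shrink
    along the slice and then fail to cover an irrational point in between, and
    local comparisons could not be chained across it.

    The remedy is to tie the size of the arc to the height. Let [radius s] be
    the largest [r <= 1] such that, at all heights below [r], [k] is increasing
    on the ball of radius [r] about [s]. This function is positive by the local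
    behaviour of [k] at the bottom circle, and 1-Lipschitz, hence continuous,
    by the triangle inequality ([radius_lipschitz]). If the slice of an arc at
    height [t] lies below [radius], then every rational point of the arc has
    radius greater than [t]. This bound is uniform, so finitely many rational
    intermediate points join any two points of the arc, and transitivity in [C]
    gives the comparison ([radius_chain]). Finally, the minimum of [radius] with
    any member of [W_H] is again in [W_H] ([W_H_minl]), which provides [h]. *)

Set Implicit Arguments.
Unset Strict Implicit.
Unset Printing Implicit Defensive.

Import Order.TTheory GRing.Theory Num.Theory numFieldNormedType.Exports.
Local Open Scope classical_set_scope.
Local Open Scope ring_scope.

Section Proof.
Variable R : realType.
Local Notation S1Q := (S1Q R).
Local Notation unitI := (unitI R).
Local Notation unitIoc := (unitIoc R).
Local Notation cyl := (los_prod (dS1Q_los R) (unitI_los R)).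

(** * The maps i0, c0 and q are morphisms *)

Lemma bases_cyl :
  bases cyl (prod_basis (@arc_basis R) (@eq_basis unitI)).
Proof. by apply: bases_prod; exact: bases_of_basis. Qed.

Lemma bases_W : bases (W_los R) (@W_basis R).
Proof. exact: bases_of_basis. Qed.

Lemma open_I_itv (c d : R) : open [set t : unitI | c < val t < d].
Proof.
rewrite openE => t /andP[ct td]; apply/nbhs_I.
exists (Num.min (val t - c) (d - val t)).
  by rewrite lt_min; apply/andP; split; lra.
by move=> t'; rewrite lt_min !ltr_norml => /andP[/andP[? ?] /andP[? ?]];
   apply/andP; split; lra.
Qed.

(** The radius of a box about a point of height [t] that stays off the apex. *)
Lemma small_radius (t : unitIoc) (e0 : R) : 0 < e0 ->
  exists e, [/\ 0 < e <= 1, e <= e0 & 0 < val t - e].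
Proof.
move=> e00; have /andP[t0 t1] := Ioc_bounds t.
have h : Num.min e0 (val t / 2) <= val t / 2 by rewrite ge_min lexx orbT.
exists (Num.min e0 (val t / 2)); split; [|by rewrite ge_min lexx|lra].
by rewrite lt_min e00 andTb; apply/andP; split; lra.
Qed.

Lemma WqP (s : S1Q) (t : unitI) :
  (val t = 0 /\ Wq (s, t) = None) \/
  exists2 t' : unitIoc, val t = val t' & Wq (s, t) = Some (s, t').
Proof.
have /andP[+ t1] := I_bounds t; rewrite le_eqVlt => /orP[/eqP t0|t0].
  by left; rewrite Wq0.
have [|t' et'] := @Ioc_mk R (val t); first by rewrite t0.
by right; exists t' => //; exact: WqS.
Qed.

Lemma i0_morphism : is_morphism (@i0 R).
Proof.
move=> s; apply/(locally_increasing_atE _ _ (bases_of_basis _) bases_cyl).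
move=> _ [_ [_ [[a [b [ab ->]]] [U oU <-] ->]]] [/= sab U0].
exists (eq_poset (arcQ a b)); split=> //.
- by exists (arcQ a b) => //; exact: open_arcQ.
- by move=> _ [u /= hu <-].
- by move=> u _ [hu <-]; split=> //=; exact: arc_le_refl.
Qed.

Lemma c0_morphism : is_morphism (@c0 R).
Proof.
move=> s; apply/(locally_increasing_atE _ _ (bases_of_basis _) bases_cyl).
move=> B' _ hB'; exists (eq_poset setT); split=> //.
- by exists setT => //; exact: openT.
- by move=> _ [u _ <-].
- by move=> u _ [_ <-]; exact: ple_refl.
Qed.

(** Over the apex, continuity of [h] gives an arc about [s] on which [h] exceeds
    [h s / 2]. The cylinder of that height over the arc lands in [O_h], and the
    same arc witnesses the order of [O_h] in each slice. Elsewhere [q] is a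
    bijection between boxes. *)
Lemma q_morphism : is_morphism (@q R).
Proof.
move=> [s t]; apply/(locally_increasing_atE _ _ bases_cyl bases_W) => B' hB'.
have [r er] := S1Q_angle s.
rewrite /q; have [[t0 ->]|[t' et ->]] := WqP s t => hst.
  case: hB' hst => [[h [Hh ->]] _|[a [b [c [d [ab [_ ->]]]]]] //].
  have [hc hb _] := Hh; have /andP[h0 h1] := hb s.
  have nA : nbhs s (h @^-1` [set y | h s / 2 < y]).
    by apply: hc; apply: open_nbhs_nbhs; split; [exact: open_gt|rewrite /=; lra].
  have [d d0 hd] := arcQ_nbhs er nA.
  have e1 : 0 < Num.min d 1 <= 1 by rewrite lt_min d0 ltr01 ge_min lexx orbT.
  have ed : Num.min d 1 <= d by rewrite ge_min lexx.
  move: e1 ed; move: (Num.min d 1) => e e1 ed.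
  have /andP[e0 _] := e1.
  have K (u : S1Q) (v : unitIoc) : arcQ (ratr r - e) (ratr r + e) u ->
      val v < h s / 2 -> W_O h (Some (u, v)).
    move=> hu hv; apply: lt_trans hv _; apply: hd; apply: arc_sub hu; lra.
  exists (prod_poset (arc_poset (proper_arc_center (ratr r) e1))
                     (eq_poset [set v : unitI | -1 < val v < h s / 2])).
  split.
  - do 2 eexists; split; [by do 3 eexists|  |reflexivity].
    by eexists; last reflexivity; exact: open_I_itv.
  - split; first exact: arcQ_center.
    by rewrite /= t0; apply/andP; split; lra.
  - move=> _ [[u v] [/= hu /andP[_ hv]] <-].
    have [[_ ->]//|[v' ev ->]] := WqP u v.
    by apply: K; rewrite // -ev.
  - move=> [u v] [u' _] [/= huu' [/andP[_ hv] <-]].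
    have [[v0 ->]|[v' ev ->]] := WqP u v; first by rewrite Wq0.
    rewrite (WqS _ ev); split=> //.
    exists (ratr r - e), (ratr r + e); split=> //.
      exact: proper_arc_center.
    by move=> _ [w hw <-]; apply: K; rewrite // -ev.
have [e0 e00 H] := W_basis_local er hB' hst.
have [e [e1 ee0 te]] := small_radius t' e00.
have /andP[e_gt0 _] := e1.
have [S L] := H e e1 ee0.
have pos (v : unitI) : val t' - e < val v < val t' + e -> 0 < val v.
  by move=> /andP[]; lra.
exists (prod_poset (arc_poset (proper_arc_center (ratr r) e1))
         (eq_poset [set v : unitI | val t' - e < val v < val t' + e])); split.
- do 2 eexists; split; [by do 3 eexists|  |reflexivity].
  by eexists; last reflexivity; exact: open_I_itv.
- split; first exact: arcQ_center.
  by apply/andP; split; rewrite et; lra.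
- move=> _ [[u v] [/= hu hv] <-]; apply: S.
  have [[v0 _]|[v' ev ->]] := WqP u v; first by have := pos _ hv; rewrite v0 ltxx.
  by split=> //; rewrite -ev.
- move=> [u v] [u' _] [/= huu' [hv <-]]; apply: L.
  have [[v0 _]|[v' ev ->]] := WqP u v; first by have := pos _ hv; rewrite v0 ltxx.
  by rewrite (WqS _ ev); split=> //; rewrite -ev.
Qed.

Lemma q_coequalizes : @q R \o @i0 R = @q R \o @c0 R.
Proof. by apply/funext => s; rewrite /= /q /i0 /c0 !Wq0. Qed.

(** * A section of q *)

Lemma Ioc_in_I (t : unitIoc) : `[0, 1]%classic (val t : R).
Proof. by rewrite /= in_itv /=; have /andP[/ltW-> ->] := Ioc_bounds t. Qed.

Definition I_of_Ioc (t : unitIoc) : unitI := exist _ (val t) (mem_set (Ioc_in_I t)).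

Definition Wsec (w : Wspace R) : cyl :=
  if w is Some (s, t) then (s, I_of_Ioc t) else (S1Q1 R, I0 R).

Lemma WsecK : cancel Wsec (@q R).
Proof. by move=> [[s t]|] /=; [exact: WqS|exact: Wq0]. Qed.

Lemma WqK (s : S1Q) (t : unitI) :
  Wsec (Wq (s, t)) = if val t == 0 then (S1Q1 R, I0 R) else (s, t).
Proof.
have [[-> ->]|[t' et ->]] := WqP s t; first by rewrite eqxx.
have /andP[t0 _] := Ioc_bounds t'.
by rewrite et gt_eqF //=; congr pair; exact: val_inj.
Qed.

(** * The radius on which a relation holds between neighbours *)

(** The bound 1 is a choice: any bound that rules out wrapping around the circle
    would do. Unlike the order of an arc, this relation mentions no arc, so it
    can be used together with balls about varying centres. *)
Definition ccw (u v : S1Q) : Prop :=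
  exists x y : R, [/\ val u = expi x, val v = expi y & x <= y <= x + 1].

Lemma ccw_refl u : ccw u u.
Proof.
by have [r er] := S1Q_angle u; exists (ratr r), (ratr r); split=> //; lra.
Qed.

(** The angles given by [ccw] and the angles close to that of [s] have the same
    difference modulo a full turn, and both differences are too small for a full
    turn to separate them. *)
Lemma ccw_arc_le (s : S1Q) (x e : R) : val s = expi x -> 0 < e ->
  exists2 d, 0 < d & forall u v : S1Q,
    cdist (val s) (val u) < d -> cdist (val s) (val v) < d ->
    ccw u v -> arc_le (x - e) (x + e) (val u) (val v).
Proof.
move=> es e0.
have m0 : 0 < Num.min e 1 by rewrite lt_min e0 ltr01.
have me : Num.min e 1 <= e by rewrite ge_min lexx.
have m1 : Num.min e 1 <= 1 by rewrite ge_min lexx orbT.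
have [d d0 H] := arc_small x m0; exists d => // u v.
rewrite es => hu hv [y [z [ey ez /andP[yz zy]]]].
move: hu; rewrite ey => /H[y' [+ ey']]; rewrite ltr_norml => /andP[? ?].
move: hv; rewrite ez => /H[z' [+ ez']]; rewrite ltr_norml => /andP[? ?].
have pi2 := pi_ge2 R.
(* [z - y] lies between 0 and 1 and [z' - y'] between -2 and 2; they agree
   modulo 2 pi, and they differ by less than 2 pi. *)
have E : z - y = z' - y'.
  apply: expi_inj; first by rewrite ltr_norml; apply/andP; split; lra.
  by rewrite !expiD ez'; congr (_ * _); rewrite /expi !cosN !sinN; case: ey' => -> ->.
by apply/arc_le_inE; exists y', z'; split=> //; lra.
Qed.

Section Radius.
Variable L : unitIoc -> S1Q -> S1Q -> Prop.

(** Both points range over the ball, instead of one of them being its centre;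
    this is what makes [radius] Lipschitz. The same number bounds the heights,
    so that a point of height [t] below the radius has a ball of radius more
    than [t]. *)
Definition ordered_within (s : S1Q) (r : R) : Prop :=
  forall (u v : S1Q) (t : unitIoc), cdist (val s) (val u) < r ->
    cdist (val s) (val v) < r -> val t < r -> ccw u v -> L t u v.

Definition radii s : set R := [set r | 0 <= r <= 1 /\ ordered_within s r].

Definition radius s : R := sup (radii s).

Lemma radii0 s : radii s 0.
Proof.
split; first by rewrite lexx ler01.
by move=> u v t; rewrite ltNge cdist_ge0.
Qed.

Lemma radius_ub s r : radii s r -> r <= radius s.
Proof. by move=> h; apply: ub_le_sup => //; exists 1 => r' [/andP[]]. Qed.

Lemma radius_ge0 s : 0 <= radius s.
Proof. exact/radius_ub/radii0. Qed.

Lemma radius_le1 s : radius s <= 1.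
Proof. by apply: ge_sup; [exists 0; exact: radii0|move=> r [/andP[]]]. Qed.

Lemma radius_gt0 s : (exists2 r, 0 < r & ordered_within s r) -> 0 < radius s.
Proof.
move=> [r r0 H]; apply: (@lt_le_trans _ _ (Num.min r 1)).
  by rewrite lt_min r0 ltr01.
apply: radius_ub; split.
  by rewrite le_min ltW //= ler01 ge_min lexx orbT.
move=> u v t; rewrite !lt_min => /andP[? _] /andP[? _] /andP[? _]; exact: H.
Qed.

(** The ball of radius [r - d] about [s'] lies in the ball of radius [r] about
    [s], where [d] is the distance between the centres. *)
Lemma radius_lipschitz s s' :
  radius s <= radius s' + cdist (val s) (val s').
Proof.
apply: ge_sup; first by exists 0; exact: radii0.
move=> r [/andP[r0 r1] H]; rewrite -lerBlDr.
have [h|h] := leP (r - cdist (val s) (val s')) 0.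
  exact: le_trans h (radius_ge0 _).
have d0 := cdist_ge0 (val s) (val s').
apply: radius_ub; split; first by apply/andP; split; lra.
move=> u v t hu hv ht; apply: H.
- by apply: le_lt_trans (cdist_triangle _ (val s') _) _; lra.
- by apply: le_lt_trans (cdist_triangle _ (val s') _) _; lra.
- by apply: lt_le_trans ht _; lra.
Qed.

Lemma lt_radius (s u : S1Q) (t : unitIoc) : val t < radius s ->
  cdist (val s) (val u) < val t -> ccw s u -> L t s u.
Proof.
move=> /sup_gt[|r [_ H] tr hu]; first by exists 0; exact: radii0.
have /andP[t0 _] := Ioc_bounds t.
by apply: H; rewrite ?cdistuu //; lra.
Qed.

(** Neighbours at angular distance less than some [d] depending only on [t] are
    related, so an induction on the length of the arc between the two points, in
    units of [d / 2], relates its ends. *)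
Lemma radius_chain (a b : R) (t : unitIoc) :
  (forall u v w, L t u v -> L t v w -> L t u w) ->
  (forall u : S1Q, arcQ a b u -> val t < radius u) ->
  forall s s' : S1Q, arc_le a b (val s) (val s') -> L t s s'.
Proof.
move=> Ltr Hab s s' /arc_le_inE[x [y [ax xy yb es es']]].
have /andP[t0 _] := Ioc_bounds t.
have [d' d'0 Hd'] := expi_cont (0 : R) t0.
pose d := Num.min d' 1.
have d0 : 0 < d by rewrite lt_min d'0 ltr01.
have dd' : d <= d' by rewrite ge_min lexx.
have d1 : d <= 1 by rewrite ge_min lexx orbT.
have step (u v : S1Q) z w : val u = expi z -> val v = expi w ->
    a < z -> z <= w -> w < b -> w - z < d -> L t u v.
  move=> eu ev az zw wb wz; apply: lt_radius.
  - by apply: Hab; apply/arc_inE; exists z => //; apply/andP; split; lra.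
  - have : cdist (expi 0) (expi (w - z)) < val t.
      by apply: Hd'; rewrite subr0 ger0_norm; lra.
    by rewrite eu ev !cdist_expi sub0r opprB.
  - by exists z, w; split=> //; apply/andP; split; lra.
have [n hn] : exists n : nat, y - x <= n%:R * (d / 2).
  exists (Num.bound ((y - x) / (d / 2))).
  have d20 : 0 < d / 2 by lra.
  by rewrite -ler_pdivrMr // ltW // archi_boundP // divr_ge0 ?subr_ge0 // ltW.
elim: n => [|n IHn] in y s' xy yb es' hn *.
  by apply: (step _ _ x y) => //; lra.
have [yx|yx] := ltP (y - x) d; first exact: (step _ _ x y).
(* The new point is within [d] of the end, and at least [d / 2] before it, which
   uses up one unit of length. *)
have [|r] := @rat_in_itvoo R (y - d) (y - d / 2); first by lra.
rewrite in_itv /= => /andP[r1 r2].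
have [u eu] := S1Q_rat R r.
apply: (Ltr _ u).
  by apply: (IHn (ratr r)) => //; move: hn; rewrite -natr1 mulrDl mul1r; lra.
by apply: (step _ _ (ratr r) y) => //; lra.
Qed.

End Radius.

(** The function [g] need not have infimum 0; the minimum inherits it from
    [h]. *)
Lemma W_H_minl (g h : S1Q -> R) : continuous g -> (forall s, 0 < g s <= 1) ->
  W_H h -> W_H (g \min h).
Proof.
move=> gc gb Hh; have [hc hb _] := Hh; apply/W_HP.
- by move=> s; apply: (@continuous_min R _ g h s); [exact: gc|exact: hc].
- move=> s /=; have /andP[? ?] := gb s; have /andP[? ?] := hb s.
  by rewrite lt_min ge_min; apply/andP; split; [apply/andP|apply/orP; left].
- move=> e /((W_HP hc hb).1 Hh)[s hs]; exists s => /=.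
  by rewrite gt_min hs orbT.
Qed.

(** * Descent of a morphism along q *)

Section Descent.
Variables (Z : lospace) (k : cyl -> Z).
Hypothesis km : is_morphism k.

(** Both at the apex and away from it, the behaviour of [k] is used in this form,
    with a single number bounding the arc and the range of heights. *)
Lemma cyl_local BZ (C : poset Z) (s : S1Q) (t : unitI) x :
  bases Z BZ -> BZ C -> carrier C (k (s, t)) -> val s = expi x ->
  exists2 e0, 0 < e0 & forall e, 0 < e <= e0 -> forall u v (t' : unitI),
    `|val t - val t'| < e -> arc_le (x - e) (x + e) (val u) (val v) ->
    ple C (k (u, t')) (k (v, t')).
Proof.
move=> hZ hC Cst es.
have [_ [[_ [_ [[a [b [ab ->]]] [U oU <-] ->]]] [/= sab Ut] _ L]] :=
  (locally_increasing_atE k (s, t) bases_cyl hZ).1 (@km (s, t)) C hC Cst.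
have [d d0 Hd] := arc_local es sab.
have [d' d'0 Hd'] := (nbhs_I _ _).1 (open_nbhs_nbhs (conj oU Ut)).
exists (Num.min d d'); first by rewrite lt_min d0.
move=> e; rewrite le_min => /and3P[e0 ed ed'] u v t' ht' uv.
apply: L; split=> /=; first by apply: (Hd e _).2; rewrite ?e0.
by split=> //; apply: Hd'; lra.
Qed.

Lemma descent_at_some (s : S1Q) (t : unitIoc) :
  @locally_increasing_at (W_los R) Z (k \o Wsec) (Some (s, t)).
Proof.
have [BZ oZ eZ] := basesP Z.
have hZ : bases Z BZ by rewrite eZ; split=> //; exact: equiv_bases_refl.
apply/(locally_increasing_atE _ _ bases_W hZ) => C hC Cst.
have [r er] := S1Q_angle s.
have [e0 e00 H] := cyl_local hZ hC Cst er.
have [e [e1 ee0 te]] := small_radius t e00; have /andP[e_gt0 _] := e1.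
have K (u v : S1Q) (t' : unitIoc) : val t - e < val t' < val t + e ->
    arc_le (ratr r - e) (ratr r + e) (val u) (val v) ->
    ple C (k (u, I_of_Ioc t')) (k (v, I_of_Ioc t')).
  move=> /andP[? ?]; apply: (H e); first by rewrite e_gt0.
  have : `|val t - val t'| < e by rewrite ltr_norml; apply/andP; split; lra.
  exact.
exists (W_box_poset (val t - e) (val t + e) (proper_arc_center (ratr r) e1)).
split.
- right; do 5 eexists; split; last reflexivity.
  by rewrite te andTb; lra.
- by split; [exact: arcQ_center|apply/andP; split; lra].
- move=> _ [[[u t']|] // [hu ht'] <-].
  by have [] := ple_carrier (K u u t' ht' (arc_le_refl hu)).
- by move=> [[u t']|] [[v t'']|] // [uv <- ht']; exact: K.
Qed.

Hypothesis k_collapse : forall s s', k (s, I0 R) = k (s', I0 R).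

(** [L] is the order of [C] between the images of two points of the same height;
    the basis element sought is [O_h] with [h] the minimum of its radius and a
    member of [W_H]. *)
Lemma descent_at_none :
  @locally_increasing_at (W_los R) Z (k \o Wsec) None.
Proof.
have [BZ oZ eZ] := basesP Z.
have hZ : bases Z BZ by rewrite eZ; split=> //; exact: equiv_bases_refl.
apply/(locally_increasing_atE _ _ bases_W hZ) => C hC C0.
pose L (t : unitIoc) (u v : S1Q) :=
  ple C (k (u, I_of_Ioc t)) (k (v, I_of_Ioc t)).
have Lloc s : exists2 r, 0 < r & ordered_within L s r.
  have [r er] := S1Q_angle s.
  have Cs : carrier C (k (s, I0 R)) by rewrite (k_collapse s (S1Q1 R)).
  have [e e0 H] := cyl_local hZ hC Cs er.
  have [d d0 Hd] := ccw_arc_le er e0.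
  exists (Num.min d e); first by rewrite lt_min d0.
  move=> u v t; rewrite !lt_min => /andP[hu _] /andP[hv _] /andP[_ ht] uv.
  apply: (H e); [by rewrite e0 lexx| |exact: Hd].
  by have /andP[t0 _] := Ioc_bounds t; rewrite /= sub0r normrN gtr0_norm.
have rc : continuous (radius L).
  by apply: lipschitz_cont; exact: radius_lipschitz.
have rb s : 0 < radius L s <= 1 by rewrite radius_gt0 //= radius_le1.
(* [heightH] of the whole space is just some member of [W_H]. *)
have Hh := W_H_minl rc rb (heightH_W_H openT (I : setT (None : Wspace R))).
move: Hh; set h := _ \min _ => Hh.
have hr s : h s <= radius L s by rewrite /h /= ge_min lexx.
exists (W_O_poset Hh); split=> //.
- by left; do 2 eexists.
- move=> _ [[[u t]|] /= ht <-]; last exact: C0.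
  have Luu : L t u u.
    apply: lt_radius (ccw_refl u); first exact: lt_le_trans ht (hr u).
    by rewrite cdistuu; case/andP: (Ioc_bounds t).
  by have [] := ple_carrier Luu.
- move=> [[u t]|] [[v t']|] //=; last by move=> _; exact: ple_refl C0.
  move=> [<- [a [b [ab uv Hab]]]].
  apply: (radius_chain (L := L) _ _ uv); first by move=> ? ? ?; exact: ple_trans.
  move=> w hw; apply: lt_le_trans (hr w).
  by apply: (Hab (Some (w, t))); exists w.
Qed.

Lemma descent_morphism : @is_morphism (W_los R) Z (k \o Wsec).
Proof. by move=> [[s t]|]; [exact: descent_at_some|exact: descent_at_none]. Qed.

Lemma descent_factor : (k \o Wsec) \o @q R = k.
Proof.
apply/funext => -[s t] /=; rewrite /q WqK; case: eqP => // t0.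
have -> : t = I0 R by exact: val_inj.
exact: k_collapse.
Qed.

End Descent.

End Proof.

Theorem proposition5p3 (R : realType) : is_coequalizer (@i0 R) (@c0 R) (@q R).
Proof.
split; [exact: i0_morphism|exact: c0_morphism|exact: q_morphism|
        exact: q_coequalizes|].
move=> Z k km kic.
have kc s s' : k (s, I0 R) = k (s', I0 R).
  by have /(congr1 (fun f => f s)) := kic; have /(congr1 (fun f => f s')) := kic => /= -> ->.
exists (k \o @Wsec R); split.
  by split; [exact: descent_morphism|exact: descent_factor].
by move=> k' [_ <-]; apply/funext => w /=; rewrite WsecK.
Qed.
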